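(* Let $A$ be a pseudocompact C$^*$-algebra and let $p\in A$ be a nonzero projection. Then $p$ is minimal if and only if $pAp=\mathbb{C}p$.
   Context: A nonzero projection $p$ is minimal if it has no subprojection other than $0$ and $p$. $M_n$ denotes the C$^*$-algebra of complex $n\times n$ matrices, $n\ge 1$. Finite-dimensional C$^*$-algebras are, up to isomorphism, the (nonempty) finite direct sums of matrix algebras $M_n$. Continuous logic for C$^*$-algebras: atomic formulae are norms $\|P(x_1,\dots,x_k)\|$ of $*$-polynomials with complex coefficients (a constant $I$ for the identity may be used when the algebras are unital); formulae are built from these by applying continuous real-valued functions to finitely many formulae and by taking $\sup$ or $\inf$ of a variable over the closed unit ball. A sentence is a formula without free variables; $\varphi^A\in\mathbb{R}$ is its value in $A$. $A\equiv B$ (elementarily equivalent) if $\varphi^A=\varphi^B$ for every sentence $\varphi$. For an ultrafilter $\mathcal{U}$ on a set $I$, the ultraproduct $\prod_{\mathcal{U}}A_i$ is the C$^*$-algebra of bounded families $(a_i)_{i\in I}$ modulo those with $\lim_{\mathcal{U}}\|a_i\|=0$. A C$^*$-algebra is pseudocompact if it is elementarily equivalent to an ultraproduct of finite-dimensional C$^*$-algebras. *)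

(* Defs.v *)
From HB Require Import structures.
From mathcomp Require Import all_boot all_order all_algebra.
From mathcomp Require Import ring_quotient complex.
From mathcomp Require Import all_classical all_reals topology normedtype sequences.
From mathcomp Require Import lra.

Set Implicit Arguments.
Unset Strict Implicit.
Unset Printing Implicit Defensive.

Import Order.TTheory GRing.Theory Num.Theory.
Import numFieldNormedType.Exports.

Local Open Scope classical_set_scope.
Local Open Scope ring_scope.
Local Open Scope complex_scope.

(** C*-algebras, not assumed unital.  The norm of a [normedModType R[i]] takes
    its values in [R[i]]; [nrm] below is the same norm with values in [R]. *)
HB.mixin Record CompleteNormedModule_isCStarAlgebra (R : realType) (A : Type)
    & CompleteNormedModule R[i] A := {
  cmul : A -> A -> A;
  cstar : A -> A;
  cmulA : associative cmul;
  cmulDl : left_distributive cmul +%R;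
  cmulDr : right_distributive cmul +%R;
  cmulZl : forall (c : R[i]) x y, cmul (c *: x) y = c *: cmul x y;
  cmulZr : forall (c : R[i]) x y, cmul x (c *: y) = c *: cmul x y;
  cstarK : involutive cstar;
  cstarD : {morph cstar : x y / x + y};
  cstarZ : forall (c : R[i]) x, cstar (c *: x) = c^* *: cstar x;
  cstarM : forall x y, cstar (cmul x y) = cmul (cstar y) (cstar x);
  cnormM : forall x y : A, `|cmul x y| <= `|x| * `|y|;
  cnorm_cstar_mul : forall x : A, `|cmul (cstar x) x| = `|x| ^+ 2
}.

#[short(type="cstarAlgType")]
HB.structure Definition CStarAlgebra (R : realType) :=
  {A of CompleteNormedModule R[i] A & CompleteNormedModule_isCStarAlgebra R A}.

Notation "x ** y" := (cmul x y) (at level 40, left associativity) : ring_scope.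

Definition nrm (R : realType) (V : normedModType R[i]) (x : V) : R := complex.Re `|x|.

Section Projections.
Variables (R : realType) (A : cstarAlgType R).

Definition projection (p : A) : Prop := p ** p = p /\ cstar p = p.

Definition subprojection (q p : A) : Prop := projection q /\ p ** q = q.

Definition minimal_projection (p : A) : Prop :=
  [/\ projection p, p <> 0 &
      forall q : A, subprojection q p -> q = 0 \/ q = p].

Definition corner (p : A) : set A := [set p ** x ** p | x in [set: A]].

Definition scalar_multiples (p : A) : set A := [set c *: p | c in [set: R[i]]].

(* Nonzero, and of finite dimension as a complex vector space. *)
Definition finite_dimensional : Prop :=
  (exists x : A, x <> 0) /\
  exists n (b : 'I_n -> A),
    forall x, exists c : 'I_n -> R[i], x = \sum_i c i *: b i.

End Projections.

Section ContinuousLogic.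
Variable R : realType.

(* Variables are named by natural numbers.  There is no constant term, since
   the algebras need not be unital. *)
Inductive star_poly : Type :=
| PVar of nat
| PZero
| PAdd of star_poly & star_poly
| PScale of R[i] & star_poly
| PMul of star_poly & star_poly
| PStar of star_poly.

Inductive formula : Type :=
| FNorm of star_poly
| FConn (n : nat) (f : 'rV[R]_n -> R) of continuous f & ('I_n -> formula)
| FSup of nat & formula
| FInf of nat & formula.

Fixpoint occurs_in (x : nat) (P : star_poly) : Prop :=
  match P with
  | PVar y => x = y
  | PZero => False
  | PAdd P1 P2 | PMul P1 P2 => occurs_in x P1 \/ occurs_in x P2
  | PScale _ P1 | PStar P1 => occurs_in x P1
  end.

Fixpoint free_in (x : nat) (phi : formula) : Prop :=
  match phi with
  | FNorm P => occurs_in x P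
  | FConn _ _ _ args => exists i, free_in x (args i)
  | FSup y psi | FInf y psi => x <> y /\ free_in x psi
  end.

Definition sentence (phi : formula) : Prop := forall x, ~ free_in x phi.

Section Interpretation.
Variable A : cstarAlgType R.

Definition assign (e : nat -> A) (x : nat) (a : A) : nat -> A :=
  fun y => if y == x then a else e y.

Fixpoint poly_eval (e : nat -> A) (P : star_poly) : A :=
  match P with
  | PVar x => e x
  | PZero => 0
  | PAdd P1 P2 => poly_eval e P1 + poly_eval e P2
  | PScale c P1 => c *: poly_eval e P1
  | PMul P1 P2 => poly_eval e P1 ** poly_eval e P2
  | PStar P1 => cstar (poly_eval e P1)
  end.

Definition unit_ball : set A := [set a | nrm a <= 1].

(* [e] is meant to take its values in the unit ball: formulae are then bounded,
   so that [sup] and [inf] are the true bounds. *)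
Fixpoint eval (e : nat -> A) (phi : formula) : R :=
  match phi with
  | FNorm P => nrm (poly_eval e P)
  | FConn n f _ args => f (\row_(i < n) eval e (args i))
  | FSup x psi => sup [set eval (assign e x a) psi | a in unit_ball]
  | FInf x psi => inf [set eval (assign e x a) psi | a in unit_ball]
  end.

(* For a sentence the choice of the initial assignment is immaterial. *)
Definition value (phi : formula) : R := eval (fun=> 0) phi.

End Interpretation.

Definition elementarily_equivalent (A B : cstarAlgType R) : Prop :=
  forall phi : formula, sentence phi -> value A phi = value B phi.

End ContinuousLogic.

Section NormTheory.
Variable R : realType.

Lemma Re_norm_ge0 (c : R[i]) : 0 <= complex.Re `|c|.
Proof. by rewrite -lecR RRe_real ?normr_real ?normr_ge0. Qed.

Section Normed.
Variable V : normedModType R[i].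
Implicit Types x y : V.

Lemma nrmE x : `|x| = (nrm x)%:C.
Proof. by rewrite /nrm RRe_real ?normr_real. Qed.

Lemma nrm_ge0 x : 0 <= nrm x.
Proof. by rewrite -lecR -nrmE normr_ge0. Qed.

Lemma nrm0 : nrm (0 : V) = 0.
Proof. by rewrite /nrm normr0. Qed.

Lemma nrm_eq0 x : nrm x = 0 -> x = 0.
Proof. by move=> x0; apply/normr0_eq0; rewrite nrmE x0. Qed.

Lemma nrmN x : nrm (- x) = nrm x.
Proof. by rewrite /nrm normrN. Qed.

Lemma nrmD x y : nrm (x + y) <= nrm x + nrm y.
Proof. by rewrite -lecR raddfD/= -!nrmE ler_normD. Qed.

Lemma nrmB x y : nrm (x - y) <= nrm x + nrm y.
Proof. by rewrite -[leRHS]/(_ + _) -(nrmN y) nrmD. Qed.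

Lemma nrm_distC x y : nrm (x - y) = nrm (y - x).
Proof. by rewrite -nrmN opprB. Qed.

Lemma nrm_distD z x y : nrm (x - y) <= nrm (x - z) + nrm (z - y).
Proof. by rewrite -[x - y](_ : (x - z) + (z - y) = _) ?nrmD// addrA subrK. Qed.

Lemma nrmZ (c : R[i]) x : nrm (c *: x) = complex.Re `|c| * nrm x.
Proof. by rewrite [LHS]/nrm normrZ !nrmE -rmorphM. Qed.

Lemma nrm_dist_dist x y : `|nrm x - nrm y| <= nrm (x - y).
Proof.
have h (u v : V) : nrm u <= nrm (u - v) + nrm v.
  by rewrite -{1}(subrK v u) nrmD.
rewrite ler_norml lerBlDr h andbT lerNl opprB lerBlDr nrm_distC; exact: h.
Qed.

End Normed.

Section CStar.
Variable A : cstarAlgType R.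
Implicit Types x y : A.

Lemma nrmM x y : nrm (x ** y) <= nrm x * nrm y.
Proof. by rewrite -lecR rmorphM/= -!nrmE cnormM. Qed.

Lemma nrm_cstar_mul x : nrm (cstar x ** x) = nrm x ^+ 2.
Proof. by apply: complexI; rewrite rmorphXn/= -!nrmE cnorm_cstar_mul. Qed.

Lemma nrm_cstar x : nrm (cstar x) = nrm x.
Proof.
have h y : nrm y <= nrm (cstar y).
  have [->|/eqP y0] := eqVneq (nrm y) 0; first exact: nrm_ge0.
  have y_gt0 : 0 < nrm y by rewrite lt_neqAle nrm_ge0 andbT eq_sym; exact/eqP.
  by rewrite -(ler_pM2r y_gt0) -expr2 -nrm_cstar_mul nrmM.
by apply/eqP; rewrite eq_le h -{2}(cstarK x) h.
Qed.

Lemma cmulN x y : (- x) ** y = - (x ** y).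
Proof. by rewrite -scaleN1r cmulZl scaleN1r. Qed.

Lemma cmulxN x y : x ** (- y) = - (x ** y).
Proof. by rewrite -scaleN1r cmulZr scaleN1r. Qed.

Lemma cmulBl x y z : (x - y) ** z = x ** z - y ** z.
Proof. by rewrite cmulDl cmulN. Qed.

Lemma cmulBr x y z : z ** (x - y) = z ** x - z ** y.
Proof. by rewrite cmulDr cmulxN. Qed.

Lemma cstarN x : cstar (- x) = - cstar x.
Proof. by rewrite -scaleN1r cstarZ rmorphN1 scaleN1r. Qed.

Lemma cstarB x y : cstar (x - y) = cstar x - cstar y.
Proof. by rewrite cstarD cstarN. Qed.

End CStar.
End NormTheory.

Section BoundedFamilies.
Variables (R : realType) (I : Type) (A : I -> cstarAlgType R).

Record bounded_family := BoundedFamily {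
  family_fun :> forall i, A i;
  family_bounded : exists M : R, forall i, nrm (family_fun i) <= M }.

HB.instance Definition _ := gen_eqMixin bounded_family.
HB.instance Definition _ := gen_choiceMixin bounded_family.

Lemma bounded_familyP (a b : bounded_family) : (forall i, a i = b i) -> a = b.
Proof.
case: a b => [a Pa] [b Pb] /= ab.
have e : a = b by exact: functional_extensionality_dep.
by subst b; congr BoundedFamily; exact: Prop_irrelevance.
Qed.

Program Definition fam0 := @BoundedFamily (fun i => 0) _.
Next Obligation. by exists 0 => i; rewrite nrm0. Qed.

Program Definition famD (a b : bounded_family) :=
  @BoundedFamily (fun i => a i + b i) _.
Next Obligation.
move=> a b; have [M aM] := family_bounded a; have [N bN] := family_bounded b.
by exists (M + N) => i; rewrite (le_trans (nrmD _ _))// lerD.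
Qed.

Program Definition famN (a : bounded_family) := @BoundedFamily (fun i => - a i) _.
Next Obligation.
by move=> a; have [M aM] := family_bounded a; exists M => i; rewrite nrmN.
Qed.

Program Definition famZ (c : R[i]) (a : bounded_family) :=
  @BoundedFamily (fun i => c *: a i) _.
Next Obligation.
move=> c a; have [M aM] := family_bounded a; exists (complex.Re `|c| * M) => i.
by rewrite nrmZ ler_wpM2l// Re_norm_ge0.
Qed.

Program Definition famM (a b : bounded_family) :=
  @BoundedFamily (fun i => a i ** b i) _.
Next Obligation.
move=> a b; have [M aM] := family_bounded a; have [N bN] := family_bounded b.
by exists (M * N) => i; rewrite (le_trans (nrmM _ _))// ler_pM ?nrm_ge0.
Qed.

Program Definition famS (a : bounded_family) :=
  @BoundedFamily (fun i => cstar (a i)) _.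
Next Obligation.
by move=> a; have [M aM] := family_bounded a; exists M => i; rewrite nrm_cstar.
Qed.

Lemma famDA : associative famD.
Proof. by move=> a b c; apply: bounded_familyP => i /=; rewrite addrA. Qed.
Lemma famDC : commutative famD.
Proof. by move=> a b; apply: bounded_familyP => i /=; rewrite addrC. Qed.
Lemma fam0D : left_id fam0 famD.
Proof. by move=> a; apply: bounded_familyP => i /=; rewrite add0r. Qed.
Lemma famND : left_inverse fam0 famN famD.
Proof. by move=> a; apply: bounded_familyP => i /=; rewrite addNr. Qed.

HB.instance Definition _ :=
  GRing.isZmodule.Build bounded_family famDA famDC fam0D famND.

Lemma famZA (c d : R[i]) (a : bounded_family) :
  famZ c (famZ d a) = famZ (c * d) a.
Proof. by apply: bounded_familyP => i /=; rewrite scalerA. Qed.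
Lemma fam1Z : left_id 1 famZ.
Proof. by move=> a; apply: bounded_familyP => i /=; rewrite scale1r. Qed.
Lemma famZDr : right_distributive famZ +%R.
Proof. by move=> c a b; apply: bounded_familyP => i /=; rewrite scalerDr. Qed.
Lemma famZDl (a : bounded_family) : {morph famZ^~ a : c d / c + d}.
Proof. by move=> c d; apply: bounded_familyP => i /=; rewrite scalerDl. Qed.

HB.instance Definition _ :=
  GRing.Zmodule_isLmodule.Build R[i] bounded_family famZA fam1Z famZDr famZDl.

Lemma famB (a b : bounded_family) i : (a - b) i = a i - b i.
Proof. by []. Qed.

End BoundedFamilies.

Lemma ultra_fmap (T T' : Type) (f : T -> T') (F : set_system T) :
  UltraFilter F -> UltraFilter (f @ F).
Proof.
move=> FU; split; first exact: fmap_proper_filter.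
move=> G GF sFG; apply/seteqP; split => // X GX.
have [//|nFX] := in_ultra_setVsetC (f @^-1` X) FU.
have /sFG GnX : (f @ F) (~` X) by [].
by exfalso; apply: (@filter_not_empty _ G); rewrite -(setICr X); exact: filterI.
Qed.

Record ultrafilter (I : Type) := MkUltrafilter {
  ultrafilter_sets :> set_system I;
  ultrafilterP : UltraFilter ultrafilter_sets }.

#[global] Existing Instance ultrafilterP.

Section Ultraproduct.
Variables (R : realType) (I : Type) (U : ultrafilter I).
Variable A : I -> cstarAlgType R.
Local Notation fam := (bounded_family A).
Local Notation uf := (ultrafilter_sets U).

Definition ultra_norm (a : fam) : R := lim ((fun i => nrm (a i)) @ uf).

Lemma ultra_cvg (a : fam) : (fun i => nrm (a i)) @ uf --> ultra_norm a.
Proof.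
suff : cvg ((fun i => nrm (a i)) @ uf) by [].
have [M aM] := family_bounded a.
have := @segment_compact R 0 M; rewrite compact_ultra => /(_ ((fun i => nrm (a i)) @ uf)).
case=> [||l [_ ?]].
- exact: ultra_fmap.
- by apply: (@filterE _ uf) => i; rewrite /= in_itv/=; apply/andP; split; [exact: nrm_ge0|exact: aM].
- by apply/cvg_ex; exists l.
Qed.

Arguments ultra_cvg a : clear implicits.

Let ultra_is_cvg (a : fam) : cvg ((fun i => nrm (a i)) @ uf).
Proof. exact: ultra_cvg. Qed.

Lemma ultra_lim_le (f g : I -> R) (l m : R) : f @ uf --> l -> g @ uf --> m ->
  (forall i, f i <= g i) -> l <= m.
Proof.
move=> fl gm fg; rewrite -subr_ge0.
have h : (fun i => g i - f i) @ uf --> m - l by exact: cvgB.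
rewrite -(cvg_lim (@Rhausdorff R) h); apply: limr_ge; first exact: (cvgP _ h).
by apply: (@filterE _ uf) => i; rewrite subr_ge0.
Qed.

Lemma ultra_norm_lim (a : fam) (l : R) :
  (fun i => nrm (a i)) @ uf --> l -> ultra_norm a = l.
Proof. by move=> al; apply: cvg_lim. Qed.

Lemma ultra_norm_le (a : fam) (M : R) :
  (\forall i \near uf, nrm (a i) <= M) -> ultra_norm a <= M.
Proof. by move=> UM; apply: limr_le => //; exact: ultra_is_cvg. Qed.

Lemma ultra_norm_ge0 (a : fam) : 0 <= ultra_norm a.
Proof.
apply: limr_ge; first exact: ultra_is_cvg.
by apply: (@filterE _ uf) => i; exact: nrm_ge0.
Qed.

Lemma ultra_norm_lt (a : fam) (M : R) :
  ultra_norm a < M -> \forall i \near uf, nrm (a i) < M.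
Proof. by move=> aM; exact: (cvgr_lt _ (ultra_cvg a)). Qed.

Lemma ultra_norm0 : ultra_norm 0 = 0.
Proof.
apply: ultra_norm_lim => /=.
rewrite (_ : (fun _ => _) = fun=> 0); first exact: cvg_cst.
by apply/funext => i /=; rewrite nrm0.
Qed.

Lemma ultra_normN (a : fam) : ultra_norm (- a) = ultra_norm a.
Proof. by congr (lim (_ @ uf)); apply/funext => i /=; rewrite nrmN. Qed.

Lemma ultra_normD (a b : fam) : ultra_norm (a + b) <= ultra_norm a + ultra_norm b.
Proof.
have h : (fun i => nrm (a i) + nrm (b i)) @ uf --> ultra_norm a + ultra_norm b.
  by apply: cvgD; exact: ultra_cvg.
by apply: (ultra_lim_le (ultra_cvg _) h) => i; exact: nrmD.
Qed.

Lemma ultra_normZ (c : R[i]) (a : fam) : ultra_norm (c *: a) = complex.Re `|c| * ultra_norm a.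
Proof.
apply: ultra_norm_lim; rewrite (_ : (fun _ => _) = (fun i => complex.Re `|c| * nrm (a i))).
  by apply: cvgM; [exact: cvg_cst|exact: ultra_cvg].
by apply/funext => i /=; rewrite nrmZ.
Qed.

Lemma ultra_normM (a b : fam) :
  ultra_norm (famM a b) <= ultra_norm a * ultra_norm b.
Proof.
have h : (fun i => nrm (a i) * nrm (b i)) @ uf --> ultra_norm a * ultra_norm b.
  by apply: cvgM; exact: ultra_cvg.
by apply: (ultra_lim_le (ultra_cvg _) h) => i; exact: nrmM.
Qed.

Lemma ultra_normS (a : fam) : ultra_norm (famS a) = ultra_norm a.
Proof. by congr (lim (_ @ uf)); apply/funext => i /=; rewrite nrm_cstar. Qed.

Lemma ultra_normSM (a : fam) : ultra_norm (famM (famS a) a) = ultra_norm a ^+ 2.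
Proof.
apply: ultra_norm_lim; rewrite (_ : (fun _ => _) = (fun i => nrm (a i) * nrm (a i))).
  by rewrite expr2; apply: cvgM; exact: ultra_cvg.
by apply/funext => i /=; rewrite nrm_cstar_mul expr2.
Qed.

Definition null_family : {pred fam} := fun a => `[< ultra_norm a = 0 >].

Lemma null_familyP (a : fam) : reflect (ultra_norm a = 0) (a \in null_family).
Proof. exact: asboolP. Qed.

Lemma null_family_le (a : fam) : ultra_norm a <= 0 -> a \in null_family.
Proof. by move=> a0; apply/null_familyP/eqP; rewrite eq_le a0 ultra_norm_ge0. Qed.

Lemma null_family_zmod_closed : zmod_closed null_family.
Proof.
split=> [|a b /null_familyP a0 /null_familyP b0].
  by apply/null_familyP; exact: ultra_norm0.
by apply: null_family_le; rewrite (le_trans (ultra_normD _ _))// ultra_normN a0 b0 addr0.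
Qed.

HB.instance Definition _ :=
  GRing.isZmodClosed.Build fam null_family null_family_zmod_closed.


Lemma ultra_norm_dist (a b : fam) : ultra_norm a <= ultra_norm (a - b) + ultra_norm b.
Proof. by rewrite -{1}(subrK b a) ultra_normD. Qed.

Definition ultraproduct : Type := Quotient.quot null_family.

HB.instance Definition _ := Choice.on ultraproduct.
HB.instance Definition _ := GRing.Zmodule.on ultraproduct.

Local Notation Q := ultraproduct.

Definition uclass (a : fam) : Q := \pi_(Quotient.quot null_family)%qT a.
Definition urepr (x : Q) : fam := repr (x : Quotient.quot null_family).

Lemma ureprK x : uclass (urepr x) = x.
Proof. exact: reprK. Qed.

Lemma uclass_eq (a b : fam) : uclass a = uclass b <-> ultra_norm (a - b) = 0.
Proof.
split=> [/eqP|ab0]; first by rewrite -Quotient.idealrBE => /null_familyP.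
by apply/eqP; rewrite -Quotient.idealrBE; apply/null_familyP.
Qed.

Lemma uclassD (a b : fam) : uclass (a + b) = uclass a + uclass b.
Proof. exact: Quotient.pi_add. Qed.

Lemma uclassN (a : fam) : uclass (- a) = - uclass a.
Proof. exact: Quotient.pi_opp. Qed.

Lemma uclassB (a b : fam) : uclass (a - b) = uclass a - uclass b.
Proof. by rewrite uclassD uclassN. Qed.

Lemma uclass0 : uclass 0 = 0.
Proof. by rewrite -(subrr 0) uclassB subrr. Qed.

Lemma urepr_uclass (a : fam) : ultra_norm (urepr (uclass a) - a) = 0.
Proof. by apply/uclass_eq; rewrite ureprK. Qed.

Definition unorm (x : Q) : R := ultra_norm (urepr x).
Definition uscale (c : R[i]) (x : Q) : Q := uclass (c *: urepr x).
Definition umul (x y : Q) : Q := uclass (famM (urepr x) (urepr y)).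
Definition ustar (x : Q) : Q := uclass (famS (urepr x)).

Lemma unorm_uclass (a : fam) : unorm (uclass a) = ultra_norm a.
Proof.
apply/eqP; rewrite eq_le /unorm; apply/andP; split.
  by rewrite (le_trans (ultra_norm_dist _ a))// urepr_uclass add0r.
rewrite (le_trans (ultra_norm_dist _ (urepr (uclass a))))//.
by rewrite -ultra_normN opprB urepr_uclass add0r.
Qed.

Lemma uscale_uclass c (a : fam) : uscale c (uclass a) = uclass (c *: a).
Proof. by apply/uclass_eq; rewrite -scalerBr ultra_normZ urepr_uclass mulr0. Qed.

Lemma umul_uclass (a b : fam) : umul (uclass a) (uclass b) = uclass (famM a b).
Proof.
apply/uclass_eq/eqP; rewrite eq_le ultra_norm_ge0 andbT.
set a' := urepr _; set b' := urepr _.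
have -> : famM a' b' - famM a b = famM (a' - a) b' + famM a (b' - b).
  apply: bounded_familyP => i.
  by rewrite /= cmulBl cmulBr addrA subrK.
rewrite (le_trans (ultra_normD _ _))// (le_trans (lerD (ultra_normM _ _) (ultra_normM _ _)))//.
by rewrite !urepr_uclass mul0r mulr0 addr0.
Qed.

Lemma ustar_uclass (a : fam) : ustar (uclass a) = uclass (famS a).
Proof.
apply/uclass_eq.
have -> : famS (urepr (uclass a)) - famS a = famS (urepr (uclass a) - a).
  by apply: bounded_familyP => i /=; rewrite cstarB.
by rewrite ultra_normS urepr_uclass.
Qed.

Definition uclassE := (uscale_uclass, umul_uclass, ustar_uclass, unorm_uclass).

Lemma uscaleA (c d : R[i]) (x : Q) : uscale c (uscale d x) = uscale (c * d) x.
Proof. by rewrite -[x]ureprK !uclassE scalerA. Qed.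
Lemma uscale1 : left_id 1 uscale.
Proof. by move=> x; rewrite -[x]ureprK !uclassE scale1r. Qed.
Lemma uscaleDr : right_distributive uscale +%R.
Proof.
by move=> c x y; rewrite -[x]ureprK -[y]ureprK -uclassD !uclassE scalerDr uclassD.
Qed.
Lemma uscaleDl (x : Q) : {morph uscale^~ x : c d / c + d}.
Proof. by move=> c d; rewrite -[x]ureprK !uclassE scalerDl uclassD. Qed.

HB.instance Definition _ :=
  GRing.Zmodule_isLmodule.Build R[i] Q uscaleA uscale1 uscaleDr uscaleDl.

Lemma uclassZ c (a : fam) : uclass (c *: a) = c *: uclass a.
Proof. by rewrite -uscale_uclass. Qed.

Lemma unorm_triangle (x y : Q) : (unorm (x + y))%:C <= (unorm x)%:C + (unorm y)%:C.
Proof.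
rewrite -[x]ureprK -[y]ureprK -uclassD !uclassE -rmorphD lecR; exact: ultra_normD.
Qed.

Lemma unormZ (c : R[i]) (x : Q) : (unorm (c *: x))%:C = `|c| * (unorm x)%:C.
Proof.
rewrite -[x]ureprK -uclassZ !uclassE ultra_normZ rmorphM.
by congr (_ * _); rewrite RRe_real ?normr_real.
Qed.

Lemma unorm_eq0 (x : Q) : (unorm x)%:C = 0 -> x = 0.
Proof.
rewrite -[x]ureprK uclassE => /complexI x0; rewrite -uclass0.
by apply/uclass_eq; rewrite subr0.
Qed.

HB.instance Definition _ := @Lmodule_isNormed.Build R[i] Q
  (fun x => (unorm x)%:C) unorm_triangle unormZ unorm_eq0.

Lemma nrm_uclass (a : fam) : nrm (uclass a) = ultra_norm a.
Proof. by rewrite -unorm_uclass. Qed.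

End Ultraproduct.

Section Completeness.
Variable R : realType.

Lemma nrm_cauchy (V : normedModType R[i]) (F : set_system V) :
  ProperFilter F -> cauchy F ->
  forall e : R, 0 < e -> exists x, F [set y | nrm (x - y) < e].
Proof.
move=> FF /cauchyP Fc e e0; have [|x Fx] := Fc e%:C; first by rewrite ltcR.
exists x; apply: filterS Fx => y; rewrite -ball_normE /ball_/=.
by rewrite nrmE ltcR.
Qed.

Lemma complex_pos (e : R[i]) : 0 < e -> exists2 r : R, 0 < r & e = r%:C.
Proof.
move=> e0; have er : e = (complex.Re e)%:C by rewrite RRe_real// gtr0_real.
by exists (complex.Re e) => //; rewrite -ltcR -er.
Qed.

Lemma nrm_cvg (V : normedModType R[i]) (F : set_system V) (x : V) : Filter F ->
  (forall e : R, 0 < e -> F [set y | nrm (x - y) < e]) -> F --> x.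
Proof.
move=> FF Fx; apply/fcvgrPdist_lt => _ /complex_pos[e e0 ->].
by apply: filterS (Fx _ e0) => y /=; rewrite nrmE ltcR.
Qed.

Lemma half_expr_small (K e : R) : 0 < e -> exists n, K * 2^-1 ^+ n < e.
Proof.
move=> e0; have : geometric K 2^-1 @ \oo --> (0 : R).
  by apply: cvg_geometric; rewrite ger0_norm; lra.
by move=> /cvgr_lt /(_ _ e0)[N _ /(_ N)] /= h; exists N; apply: h.
Qed.

Lemma nrm_seq_cvg (V : completeNormedModType R[i]) (b : nat -> V) (K : R) :
  (forall n m, (n <= m)%N -> nrm (b n - b m) <= K * 2^-1 ^+ n) ->
  exists l, forall n, nrm (b n - l) <= K * 2^-1 ^+ n.
Proof.
move=> bK; have : cvg (b @ \oo).
  apply: cauchy_cvg; apply: cauchy_exP => _ /complex_pos[e e0 ->].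
  have [n nK] := half_expr_small K e0; exists (b n); exists n => // m /= nm.
  by rewrite -ball_normE /ball_/= nrmE ltcR (le_lt_trans (bK _ _ nm)).
move=> /cvg_ex[l bl]; exists l => n; apply/ler_addgt0Pr => e e0.
have /cvgrPdist_lt /(_ e%:C) := bl; rewrite ltcR => /(_ e0)[N _ /(_ (maxn n N))].
move=> /(_ (leq_maxr _ _)) /=; rewrite nrmE ltcR => lN.
rewrite (le_trans (nrm_distD (b (maxn n N)) _ _))// lerD ?bK ?leq_maxl//.
by rewrite nrm_distC ltW.
Qed.

Section UltraproductComplete.
Variables (I : Type) (U : ultrafilter I) (A : I -> cstarAlgType R).
Local Notation Q := (ultraproduct U A).
Local Notation g n := (2^-1 ^+ n : R).

Let g_gt0 n : 0 < g n. Proof. by rewrite exprn_gt0// invr_gt0. Qed.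
Let gS n : g n.+1 = 2^-1 * g n. Proof. by rewrite exprS. Qed.

Lemma ultraproduct_seq_cvg (a : nat -> bounded_family A) :
  (forall n, ultra_norm U (a n.+1 - a n) < 2 * g n) ->
  exists l : bounded_family A, forall n, ultra_norm U (a n - l) <= 4 * g n.
Proof.
move=> aE.
pose d n i : A i :=
  if nrm (a n.+1 i - a n i) < 2 * g n then a n.+1 i - a n i else 0.
pose b := fix b n i : A i := if n is m.+1 then b m i + d m i else a 0 i.
have nrmd n i : nrm (d n i) <= 2 * g n.
  by rewrite /d; case: ifPn => [/ltW//|_]; rewrite nrm0; have := g_gt0 n; lra.
have bb i n k : nrm (b n i - b (n + k)%N i) <= 4 * g n - 4 * g (n + k)%N.
  elim: k => [|k IH]; first by rewrite addn0 !subrr nrm0.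
  rewrite (le_trans (nrm_distD (b (n + k)%N i) _ _))// addnS.
  rewrite [X in _ + nrm X](_ : _ = - d (n + k)%N i); last first.
    by rewrite /= opprD addNKr.
  by rewrite nrmN; have := nrmd (n + k)%N i; rewrite gS; lra.
have bl i : exists l : A i, forall n, nrm (b n i - l) <= 4 * g n.
  apply: nrm_seq_cvg => n m /subnKC <-; apply: (le_trans (bb _ _ _)).
  by have := g_gt0 (n + (m - n))%N; lra.
pose l i : A i := sval (cid (bl i)).
have lE i n : nrm (b n i - l i) <= 4 * g n by rewrite /l; case: cid.
have lB : exists M : R, forall i, nrm (l i) <= M.
  have [M aM] := family_bounded (a 0); exists (4 + M) => i.
  rewrite -(subrK (b 0 i) (l i)) (le_trans (nrmD _ _))// lerD ?aM//.
  by rewrite nrm_distC (le_trans (lE i 0))// expr0; lra.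
exists (BoundedFamily lB) => n.
have ab : \forall i \near ultrafilter_sets U, b n i = a n i.
  elim: n => [|n IH]; first exact: filterE.
  have aEn := ultra_norm_lt (aE n).
  move: IH aEn; apply: filterS2 => i /= -> ain.
  by rewrite /d ain addrC subrK.
by apply: ultra_norm_le; apply: filterS ab => i /= <-; exact: lE.
Qed.

Lemma ultraproduct_complete (F : set_system Q) :
  ProperFilter F -> cauchy F -> cvg F.
Proof.
move=> FF /nrm_cauchy Fc.
have [c cF] : {c : nat -> Q & forall n, F [set y | nrm (c n - y) < g n]}.
  by apply: (@choice _ _ (fun n x => F [set y | nrm (x - y) < g n])) => n; apply: Fc.
pose a n := urepr (c n).
have aE n : ultra_norm U (a n.+1 - a n) < 2 * g n.
  have [y [ny n1y]] := filter_ex (filterI (cF n) (cF n.+1)); move: ny n1y => /= ny n1y.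
  rewrite -nrm_uclass uclassB !ureprK.
  rewrite (le_lt_trans (nrm_distD y _ _))// (nrm_distC y).
  by move: n1y; rewrite gS; have := g_gt0 n; lra.
have [l lE] := ultraproduct_seq_cvg aE.
apply/cvg_ex; exists (uclass U l); apply: nrm_cvg => e e0.
have [n ne] := half_expr_small 5 e0.
apply: filterS (cF n) => y /= ny.
rewrite (le_lt_trans (nrm_distD (c n) _ _))//.
have : nrm (uclass U l - c n) <= 4 * g n.
  rewrite nrm_distC -[c n]ureprK -uclassB nrm_uclass; exact: lE.
by move: ny ne; lra.
Qed.

HB.instance Definition _ := Uniform_isComplete.Build Q ultraproduct_complete.

Lemma umulA : associative (@umul R I U A).
Proof.
move=> x y z; rewrite -[x]ureprK -[y]ureprK -[z]ureprK !uclassE.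
by congr uclass; apply: bounded_familyP => i /=; rewrite cmulA.
Qed.

Lemma umulDl : left_distributive (@umul R I U A) +%R.
Proof.
move=> x y z; rewrite -[x]ureprK -[y]ureprK -[z]ureprK -uclassD !uclassE -uclassD.
by congr uclass; apply: bounded_familyP => i /=; rewrite cmulDl.
Qed.

Lemma umulDr : right_distributive (@umul R I U A) +%R.
Proof.
move=> x y z; rewrite -[x]ureprK -[y]ureprK -[z]ureprK -uclassD !uclassE -uclassD.
by congr uclass; apply: bounded_familyP => i /=; rewrite cmulDr.
Qed.

Lemma umulZl (c : R[i]) (x y : Q) : umul (c *: x) y = c *: umul x y.
Proof.
rewrite -[x]ureprK -[y]ureprK -uclassZ !uclassE -uclassZ.
by congr uclass; apply: bounded_familyP => i /=; rewrite cmulZl.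
Qed.

Lemma umulZr (c : R[i]) (x y : Q) : umul x (c *: y) = c *: umul x y.
Proof.
rewrite -[x]ureprK -[y]ureprK -uclassZ !uclassE -uclassZ.
by congr uclass; apply: bounded_familyP => i /=; rewrite cmulZr.
Qed.

Lemma ustarK : involutive (@ustar R I U A).
Proof.
move=> x; rewrite -[x]ureprK !uclassE.
by congr uclass; apply: bounded_familyP => i /=; rewrite cstarK.
Qed.

Lemma ustarD : {morph @ustar R I U A : x y / x + y}.
Proof.
move=> x y; rewrite -[x]ureprK -[y]ureprK -uclassD !uclassE -uclassD.
by congr uclass; apply: bounded_familyP => i /=; rewrite cstarD.
Qed.

Lemma ustarZ (c : R[i]) (x : Q) : ustar (c *: x) = c^* *: ustar x.
Proof.
rewrite -[x]ureprK -uclassZ !uclassE -uclassZ.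
by congr uclass; apply: bounded_familyP => i /=; rewrite cstarZ.
Qed.

Lemma ustarM (x y : Q) : ustar (umul x y) = umul (ustar y) (ustar x).
Proof.
rewrite -[x]ureprK -[y]ureprK !uclassE.
by congr uclass; apply: bounded_familyP => i /=; rewrite cstarM.
Qed.

Lemma unormM (x y : Q) : `|umul x y| <= `|x| * `|y|.
Proof.
rewrite !nrmE -rmorphM lecR -[x]ureprK -[y]ureprK !uclassE !nrm_uclass.
exact: ultra_normM.
Qed.

Lemma unorm_star_mul (x : Q) : `|umul (ustar x) x| = `|x| ^+ 2.
Proof.
by rewrite !nrmE -rmorphXn -[x]ureprK !uclassE !nrm_uclass ultra_normSM.
Qed.

HB.instance Definition _ := CompleteNormedModule_isCStarAlgebra.Build R Q
  umulA umulDl umulDr umulZl umulZr ustarK ustarD ustarZ ustarM unormM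
  unorm_star_mul.

End UltraproductComplete.
End Completeness.

Definition pseudocompact (R : realType) (A : cstarAlgType R) : Prop :=
  exists (I : Type) (U : ultrafilter I) (B : I -> cstarAlgType R),
    (forall i, finite_dimensional (B i)) /\
    elementarily_equivalent A (ultraproduct U B).

(* Main.v *)
Require Import Defs.
From mathcomp Require Import all_boot all_order all_algebra.
From mathcomp Require Import complex.
From mathcomp Require Import all_classical all_reals topology normedtype.
From mathcomp Require Import ring lra.

Set Implicit Arguments.
Unset Strict Implicit.
Unset Printing Implicit Defensive.

Import Order.TTheory GRing.Theory Num.Theory.
Import numFieldNormedType.Exports.

Local Open Scope classical_set_scope.
Local Open Scope ring_scope.

(** The implication from right to left is a computation: if q is a projection
    below p, then q = p q p is a multiple c p, and q q = q forces c = 0 or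
    c = 1.

    For the converse, the real and imaginary parts of an element of pAp are
    self-adjoint, so it suffices to show that a self-adjoint h in pAp is a
    multiple of p.  If it is not, normalise it to an a with |a| = 1; then a
    differs from p and from -p, by at least some d > 0.  That there are a
    nonzero projection without proper subprojections and such an a in its
    corner is expressed by one sentence having a nonpositive value; the proof
    consists in showing that this value is positive in every ultraproduct of
    finite-dimensional algebras.  Three ingredients carry it.

    Finite dimension ([minimal_projection_scalar]): if p is a minimal
    projection of a finite-dimensional algebra and a in pAp is self-adjoint,
    some polynomial kills a, so a has an eigenvector x = g(a) for left
    multiplication.  It is normal, hence not nilpotent, and a multiple e of it
    is idempotent; e* e is then a nonzero projection below p, so it is p, and
    this forces e = p, so that p itself is an eigenvector.

    Weak stability ([near_projection]): a self-adjoint b with b b - b small is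
    close to a projection, which lies in every corner that contains b.  No
    spectral theory is involved: the iteration b |-> 3 b^2 - 2 b^3 squares the defect
    b b - b up to a constant, so it converges.

    The sentence ([unsplit_sentence]): a sentence cannot quantify over
    projections, only over the unit ball.  It uses substituted polynomials
    instead: u = x* x for p, u (y* + y) u for a, and w = u z* z u for the
    subprojections of p.  These are self-adjoint whatever x, y, z are, and if
    u is a projection p they lie in pAp; every subprojection of p is its own
    w.  It says that there are x and y for which u is a projection and
    u (y* + y) u has norm 1 and distance at least d from u and -u, whereas no
    z gives a w with small defect that is far from both 0 and u.

    In A it has value at most 0 ([minimal_value]), because by weak stability a
    w with small defect is close to 0 or to p.  In an ultraproduct its value
    is positive ([ultraproduct_value]): given x and y that nearly satisfy the
    first conditions, representatives of u in the factors are near projections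
    p_i, and those of u (y* + y) u cannot be near multiples of p_i; so p_i is
    not minimal, and the classes p of (p_i) and q of the proper subprojections
    (q_i) satisfy |q| = |p - q| = 1 ([ultraproduct_split]).  Then z = q
    violates the last condition.  As A and the ultraproduct give every
    sentence the same value, this is a contradiction. *)

(** * Norms and projections *)

Section CStarAlgebra.
Variables (R : realType) (A : cstarAlgType R).
Implicit Types (a b p q u v x y : A) (c : R[i]) (P Q : {poly R[i]}).

Lemma cmul0x x : 0 ** x = 0.
Proof. by have := cmulZl 0 (0 : A) x; rewrite !scale0r. Qed.

Lemma cmulx0 x : x ** 0 = 0.
Proof. by have := cmulZr 0 x (0 : A); rewrite !scale0r. Qed.

Lemma cstar0 : cstar (0 : A) = 0.
Proof. by have := cstarB (0 : A) 0; rewrite !subrr. Qed.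

Lemma nrmZR (r : R) x : nrm (real_complex R r *: x) = `|r| * nrm x.
Proof. by rewrite nrmZ normc_def/= expr0n addr0 sqrtr_sqr. Qed.

Lemma cstarZR (r : R) x : cstar (real_complex R r *: x) = real_complex R r *: cstar x.
Proof. by rewrite cstarZ; congr (_ *: _); exact: conjc_real. Qed.

Lemma cstarZi x : cstar ('i%C *: x) = - ('i%C *: cstar x).
Proof.
rewrite cstarZ -scaleNr; congr (_ *: _).
by apply/eqP; rewrite eq_complex/= oppr0 !eqxx.
Qed.

Lemma nrm_gt0 x : x <> 0 -> 0 < nrm x.
Proof.
move=> x0; rewrite lt_neqAle nrm_ge0 andbT eq_sym.
by apply/eqP => /nrm_eq0.
Qed.

Lemma nrm_projection p : projection p -> p <> 0 -> nrm p = 1.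
Proof.
move=> [pp ps] /nrm_gt0 p0; apply: (mulfI (lt0r_neq0 p0)).
by rewrite mulr1 -expr2 -nrm_cstar_mul ps pp.
Qed.

Lemma nrm_projection_le1 p : projection p -> nrm p <= 1.
Proof.
have [->|/eqP p0] := eqVneq p 0; first by rewrite nrm0.
by move=> /nrm_projection ->.
Qed.

Lemma subprojectionC p q : projection p -> subprojection q p -> q ** p = q.
Proof. by move=> [_ ps] [[_ qs] pq]; rewrite -qs -{1}ps -cstarM pq. Qed.

Lemma projectionB p q :
  projection p -> subprojection q p -> projection (p - q).
Proof.
move=> pP qp; have qp' := subprojectionC pP qp.
case: pP qp => [pp ps] [[qq qs] pq]; split; last by rewrite cstarB ps qs.
by rewrite cmulBl !cmulBr pp pq qp' qq subrr subr0.
Qed.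

(** * Polynomials in an element *)

(** The element P(a) u.  As the algebra need not have an identity, the constant
    term has to act on some element: u is p for calculus in the corner pAp, and
    a itself for polynomials in a without constant term. *)
Definition poly_at a u P : A := \sum_(i < size P) P`_i *: iter i (cmul a) u.

Lemma poly_at_widen n a u P : (size P <= n)%N ->
  poly_at a u P = \sum_(i < n) P`_i *: iter i (cmul a) u.
Proof.
move=> sP; rewrite /poly_at (big_ord_widen n (fun i => P`_i *: iter i (cmul a) u))//.
rewrite big_mkcond/=; apply: eq_bigr => i _; case: ltnP => // h.
by rewrite nth_default// scale0r.
Qed.

Lemma poly_atD a u P Q : poly_at a u (P + Q) = poly_at a u P + poly_at a u Q.
Proof.
set n := maxn (size P) (size Q).
rewrite !(@poly_at_widen n) ?leq_maxl ?leq_maxr ?size_polyD//.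
by rewrite -big_split/=; apply: eq_bigr => i _; rewrite coefD scalerDl.
Qed.

Lemma poly_atZ a u c P : poly_at a u (c *: P) = c *: poly_at a u P.
Proof.
rewrite (@poly_at_widen (size P)) ?size_scale_leq// scaler_sumr.
by apply: eq_bigr => i _; rewrite coefZ scalerA.
Qed.

Lemma poly_atN a u P : poly_at a u (- P) = - poly_at a u P.
Proof. by rewrite -scaleN1r poly_atZ scaleN1r. Qed.

Lemma poly_atB a u P Q : poly_at a u (P - Q) = poly_at a u P - poly_at a u Q.
Proof. by rewrite poly_atD poly_atN. Qed.

Lemma poly_atC a u c : poly_at a u c%:P = c *: u.
Proof.
by rewrite (@poly_at_widen 1) ?size_polyC_leq1// big_ord1 coefC.
Qed.

Lemma cmul_sumr (I : finType) (f : I -> A) x : x ** (\sum_i f i) = \sum_i x ** f i.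
Proof. by apply: big_morph => [y z|]; [exact: cmulDr|exact: cmulx0]. Qed.

Lemma cmul_suml (I : finType) (f : I -> A) x : (\sum_i f i) ** x = \sum_i f i ** x.
Proof.
by apply: (big_morph (cmul^~ x)) => [y z|]; [exact: cmulDl|exact: cmul0x].
Qed.

Lemma poly_atMX a u P : poly_at a u (P * 'X) = a ** poly_at a u P.
Proof.
rewrite (@poly_at_widen (size P).+1); last first.
  by rewrite (leq_trans (size_polyMleq _ _))// size_polyX addn2.
rewrite big_ord_recl coefMX/= scale0r add0r /poly_at cmul_sumr.
by apply: eq_bigr => i _; rewrite coefMX/= cmulZr.
Qed.

Lemma poly_atM a u P Q : poly_at a u (P * Q) = poly_at a (poly_at a u Q) P.
Proof.
elim/poly_ind: P => [|P c IH].
  by rewrite mul0r -(scale0r 0) !poly_atZ !scale0r.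
by rewrite mulrDl mulrAC !poly_atD !poly_atMX IH mul_polyC poly_atZ poly_atC.
Qed.

Lemma poly_at_cmull a u v P : poly_at a u P ** v = poly_at a (u ** v) P.
Proof.
rewrite /poly_at cmul_suml; apply: eq_bigr => i _; rewrite cmulZl; congr (_ *: _).
by elim: (val i) => //= n <-; rewrite cmulA.
Qed.

Lemma poly_at_cmulr a u v P : a ** u = u ** a ->
  u ** poly_at a v P = poly_at a (u ** v) P.
Proof.
move=> au; rewrite /poly_at cmul_sumr; apply: eq_bigr => i _; rewrite cmulZr.
by congr (_ *: _); elim: (val i) => //= n <-; rewrite !cmulA au.
Qed.

(** Reduces an identity between noncommutative expressions in a single element
    to an identity between polynomials. *)
Lemma poly_at_cmul a u v P Q : a ** u = u ** a ->
  poly_at a u P ** poly_at a v Q = poly_at a (u ** v) (P * Q).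
Proof. by move=> au; rewrite poly_at_cmull poly_at_cmulr// poly_atM. Qed.

Lemma poly_at_comm a u P : a ** u = u ** a ->
  a ** poly_at a u P = poly_at a u P ** a.
Proof. by move=> au; rewrite poly_at_cmull -au poly_at_cmulr. Qed.

Definition defect b : A := b ** b - b.

(** Equal to 3 b^2 - 2 b^3.  This polynomial fixes 0 and 1 with derivative 0
    there, so near these points it is a superattracting iteration; writing it
    as b plus a correction shows that it moves b by at most a multiple of its defect. *)
Definition newton b : A := b + defect b - (b ** defect b + b ** defect b).

(** The defect d becomes 4 d^3 - 3 d^2: the linear term cancels, hence the
    quadratic convergence. *)
Lemma defect_newton b : let d := defect b in
  defect (newton b) = d ** d ** d + d ** d ** d + d ** d ** d + d ** d ** d
                      - (d ** d + d ** d + d ** d).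
Proof.
(* Both sides are polynomials in b without constant term; [E] divides them by
   the variable, which accounts for the extra 'X in products. *)
pose E := poly_at b b.
have EM P Q : E P ** E Q = E (P * Q * 'X).
  rewrite /E poly_at_cmul// [RHS]poly_atM; congr poly_at.
  by rewrite -['X]mul1r poly_atMX -[1]/(1%:P) poly_atC scale1r.
have Eb : b = E 1 by rewrite /E -[1]/(1%:P) poly_atC scale1r.
have Ebb : b ** b = E 'X by rewrite {2}Eb /E -poly_atMX mul1r.
have [D ED dD] : exists2 D, D = 'X - 1 & defect b = E D.
  by exists ('X - 1) => //; rewrite /E poly_atB -[poly_at _ _ 'X]Ebb -[poly_at _ _ 1]Eb.
have En : newton b = E (1 + D - (D * 'X + D * 'X)).
  by rewrite /newton dD /E poly_atB !poly_atD !poly_atMX -[poly_at _ _ 1]Eb.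
rewrite /= {1}/defect En dD !EM /E -!poly_atD -!poly_atB ED.
by congr poly_at; ring.
Qed.

End CStarAlgebra.

(** * Elements close to projections *)

Section Newton.
Variables (R : realType) (A : cstarAlgType R).
Implicit Types (b p q x y : A) (e K : R).

Lemma nrm_le_cmul x y (r s : R) : nrm x <= r -> nrm y <= s -> nrm (x ** y) <= r * s.
Proof.
by move=> xr ys; rewrite (le_trans (nrmM _ _))// ler_pM ?nrm_ge0.
Qed.

Lemma cstar_defect b : cstar b = b -> cstar (defect b) = defect b.
Proof. by move=> bs; rewrite /defect cstarB cstarM bs. Qed.

Lemma cmul_defectC b : defect b ** b = b ** defect b.
Proof. by rewrite /defect cmulBl cmulBr cmulA. Qed.

Lemma cstar_newton b : cstar b = b -> cstar (newton b) = newton b.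
Proof.
move=> bs; rewrite /newton cstarB !(cstar_defect bs, cstarD, cstarM) bs.
by rewrite cmul_defectC.
Qed.

Lemma cmul_newton p b : p ** b = b -> p ** newton b = newton b.
Proof.
by move=> pb; rewrite /newton /defect !(cmulBr, cmulDr, cmulA) !pb.
Qed.

(** The C*-identity gives |b|^2 = |b b| <= |b| + |defect b|, which bounds |b| when
    the defect is bounded. *)
Lemma nrm_selfadjoint_le b e : cstar b = b -> nrm (defect b) <= e -> e <= 1/8 ->
  nrm b <= 2.
Proof.
move=> bs be e8; have := nrm_cstar_mul b; rewrite bs => bb.
have := nrmD (defect b) b; rewrite subrK bb.
have := nrm_ge0 b; nra.
Qed.

(** Halving is a weakening of the quadratic decay; it is all that a geometric
    bound on the iterates requires. *)
Lemma nrm_defect_newton b e : nrm (defect b) <= e -> e <= 1/8 ->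
  nrm (defect (newton b)) <= 2^-1 * e.
Proof.
move=> be e8; rewrite defect_newton /=; set d := defect b.
have e0 : 0 <= e by apply: le_trans be; exact: nrm_ge0.
have d2 : nrm (d ** d) <= e * e by exact: nrm_le_cmul.
have d3 : nrm (d ** d ** d) <= e * e * e by exact: nrm_le_cmul.
have D (x y : A) r s : nrm x <= r -> nrm y <= s -> nrm (x + y) <= r + s.
  by move=> xr ys; rewrite (le_trans (nrmD _ _))// lerD.
rewrite (le_trans (nrmB _ _))//.
rewrite (le_trans (lerD (D _ _ _ _ (D _ _ _ _ (D _ _ _ _ d3 d3) d3) d3)
  (D _ _ _ _ (D _ _ _ _ d2 d2) d2)))//.
have : e * e <= e * (1/8) by rewrite ler_wpM2l.
have : e * e * e <= e * e * (1/8) by rewrite ler_wpM2l// mulr_ge0.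
lra.
Qed.

Lemma nrm_newton_dist b e : cstar b = b -> nrm (defect b) <= e -> e <= 1/8 ->
  nrm (b - newton b) <= 5 * e.
Proof.
move=> bs be e8; have b2 := nrm_selfadjoint_le bs be e8.
have bd := nrm_le_cmul b2 be.
rewrite nrm_distC (_ : newton b - b = defect b - (b ** defect b + b ** defect b)).
  rewrite (le_trans (nrmB _ _))//.
  by have := nrmD (b ** defect b) (b ** defect b); lra.
by rewrite /newton addrAC (addrC b) addrK.
Qed.

Lemma eq0_geometric x K : (forall n, nrm x <= K * 2^-1 ^+ n) -> x = 0.
Proof.
move=> xK; apply: nrm_eq0; apply/eqP; rewrite eq_le nrm_ge0 andbT.
apply/ler_addgt0Pr => e e0; have [n ne] := half_expr_small K e0.
by rewrite add0r (le_trans (xK n))// ltW.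
Qed.

(** The limit of the iterates of [newton].  Each iterate is a polynomial in b
    without constant term, so the relation p b = b is inherited by the iterates
    and passes to the limit. *)
Theorem near_projection b e : cstar b = b -> nrm (defect b) <= e -> e <= 1/8 ->
  exists q, [/\ projection q, nrm (b - q) <= 10 * e &
                forall p, p ** b = b -> p ** q = q].
Proof.
move=> bs be e8.
have e0 : 0 <= e by apply: le_trans be; exact: nrm_ge0.
pose g n : R := 2^-1 ^+ n.
have g0 n : 0 <= g n by rewrite exprn_ge0// invr_ge0.
have gS n : g n.+1 = 2^-1 * g n by rewrite /g exprS.
pose B n := iter n (@newton _ _) b.
have Bs n : cstar (B n) = B n by elim: n => //= n IH; exact: cstar_newton.
have eg n : e * g n <= 1/8.
  rewrite (le_trans _ e8)// ler_piMr//.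
  by rewrite /g exprn_ile1//; lra.
have Bd n : nrm (defect (B n)) <= e * g n.
  elim: n => [|n IH]; first by rewrite /g expr0 mulr1.
  by rewrite gS mulrCA; exact: nrm_defect_newton.
have B2 n : nrm (B n) <= 2 by exact: (nrm_selfadjoint_le (Bs n) (Bd n)).
have BB n k : nrm (B n - B (n + k)%N) <= 10 * e * g n - 10 * e * g (n + k)%N.
  elim: k => [|k IH]; first by rewrite addn0 !subrr nrm0.
  rewrite (le_trans (nrm_distD (B (n + k)%N) _ _))// addnS.
  have := nrm_newton_dist (Bs (n + k)%N) (Bd (n + k)%N) (eg _).
  by move: IH; rewrite gS -/(B _); lra.
have [q qE] : exists q, forall n, nrm (B n - q) <= 10 * e * g n.
  apply: nrm_seq_cvg => n m /subnKC <-; apply: (le_trans (BB _ _)).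
  rewrite -[X in _ <= X]subr0 lerD2l lerN2 mulr_ge0//; lra.
have q2 : nrm q <= 12.
  have := nrmB (B 0%N) (B 0%N - q); rewrite opprB addrC subrK.
  have := qE 0%N; have := B2 0%N; rewrite /g expr0; lra.
exists q; split.
- split.
    apply/eqP; rewrite -subr_eq0; apply/eqP.
    apply: (@eq0_geometric _ (200 * e)) => n; rewrite -/(g n).
    have -> : q ** q - q = defect (B n) - (B n - q) ** B n - q ** (B n - q) + (B n - q).
      have sub3 (x y z : A) : (x - y) - (x - z) = z - y.
        by rewrite opprB addrC addrA subrK.
      by rewrite /defect cmulBl cmulBr !sub3 addrA subrK.
    have h1 := nrm_le_cmul (qE n) (B2 n); have h2 := nrm_le_cmul q2 (qE n).
    rewrite (le_trans (nrmD _ _))//.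
    have := nrmB (defect (B n) - (B n - q) ** B n) (q ** (B n - q)).
    have := nrmB (defect (B n)) ((B n - q) ** B n).
    have := qE n; have := Bd n.
    have : 0 <= e * g n by rewrite mulr_ge0.
    lra.
  apply/eqP; rewrite -subr_eq0; apply/eqP.
  apply: (@eq0_geometric _ (20 * e)) => n; rewrite -/(g n).
  have -> : cstar q - q = (B n - q) - cstar (B n - q).
    by rewrite cstarB Bs opprB [RHS]addrC addrA subrK.
  have := nrmB (B n - q) (cstar (B n - q)); rewrite nrm_cstar.
  have := qE n; lra.
- by have := qE 0%N; rewrite /g expr0 mulr1.
- move=> p pb; apply/eqP; rewrite -subr_eq0; apply/eqP.
  apply: (@eq0_geometric _ ((1 + nrm p) * (10 * e))) => n; rewrite -/(g n).
  have pB : p ** B n = B n by elim: n => //= n IH; exact: cmul_newton.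
  have -> : p ** q - q = (B n - q) - p ** (B n - q).
    by rewrite cmulBr pB opprB [RHS]addrC addrA subrK.
  have := nrmB (B n - q) (p ** (B n - q)).
  have := nrm_le_cmul (lexx (nrm p)) (qE n).
  have := qE n; lra.
Qed.

End Newton.

(** * Corners of finite-dimensional algebras *)

Section FiniteDimensional.
Variables (R : realType) (A : cstarAlgType R).
Implicit Types (a e f p q u x y : A) (l : R[i]) (P Q : {poly R[i]}).

(** The n + 1 elements u, a u, ..., a^n u lie in an n-dimensional space. *)
Lemma annihilating_poly a u : finite_dimensional A ->
  exists2 P, P != 0 & poly_at a u P = 0.
Proof.
move=> [_ [n [b /choice[c cE]]]].
pose M : 'M[R[i]]_(n.+1, n) := \matrix_(i, j) c (iter i (cmul a) u) j.
have : kermx M != 0.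
  by rewrite -mxrank_eq0 mxrank_ker -lt0n subn_gt0 ltnS rank_leq_col.
move=> /rowV0Pn[v /sub_kermxP vM v0]; exists (rVpoly v).
  by apply: contra_neq v0 => v0; rewrite -[v]rVpolyK v0 linear0.
rewrite (@poly_at_widen _ _ n.+1) ?size_poly//.
transitivity (\sum_j (v *m M) ord0 j *: b j).
  under eq_bigr => i _ do rewrite coef_rVpoly_ord [iter _ _ _]cE scaler_sumr.
  rewrite exchange_big/=; apply: eq_bigr => j _.
  rewrite mxE scaler_suml; apply: eq_bigr => i _.
  by rewrite scalerA mxE.
by apply: big1 => j _; rewrite vM mxE scale0r.
Qed.

(** Split an annihilating polynomial into linear factors and multiply u by them
    one at a time: the last nonzero partial product is an eigenvector. *)
Lemma poly_at_eigen a u : finite_dimensional A -> u <> 0 ->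
  exists l Q, poly_at a u Q <> 0 /\ a ** poly_at a u Q = l *: poly_at a u Q.
Proof.
move=> /(annihilating_poly a u)[P P0 aP] u0.
have [r rE] := closed_field_poly_normal P.
have {P P0 aP rE} : poly_at a u (\prod_(z <- r) ('X - z%:P)) = 0.
  move: aP; rewrite rE poly_atZ => /eqP; rewrite scaler_eq0 lead_coef_eq0.
  by rewrite (negbTE P0) => /eqP.
elim: r => [|z r IH]; first by rewrite big_nil -polyC1 poly_atC scale1r.
rewrite big_cons mulrC; set Q := \prod_(_ <- _) _.
have [/IH//|/eqP Q0] := eqVneq (poly_at a u Q) 0.
rewrite mulrBr poly_atB poly_atMX mulrC mul_polyC poly_atZ => /eqP.
by rewrite subr_eq0 => /eqP az; exists z, Q.
Qed.

Lemma poly_at_eigenvector a x l Q : a ** x = l *: x ->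
  poly_at a x Q = Q.[l] *: x.
Proof.
move=> ax; elim/poly_ind: Q => [|Q c IH].
  by rewrite horner0 -polyC0 poly_atC.
by rewrite poly_atD poly_atMX poly_atC IH cmulZr ax scalerA -scalerDl !hornerE.
Qed.

Lemma cstar_cmul_eq0 x : cstar x ** x = 0 -> x = 0.
Proof.
move=> x0; apply: nrm_eq0; apply/eqP; rewrite -sqrf_eq0.
by rewrite -nrm_cstar_mul x0 nrm0.
Qed.

(** A normal x has (x* x)^2 = x* x* x x, so the C*-identity applies twice. *)
Lemma normal_square_eq0 x : cstar x ** x = x ** cstar x -> x ** x = 0 -> x = 0.
Proof.
move=> xn xx; apply/cstar_cmul_eq0/cstar_cmul_eq0.
by rewrite cstarM cstarK {2}xn cmulA -(cmulA _ x x) xx cmulx0 cmul0x.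
Qed.

(** Avoids showing that e itself is self-adjoint, which would require the
    eigenvalues of self-adjoint elements to be real. *)
Lemma normal_idempotent_projection e : cstar e ** e = e ** cstar e ->
  e ** e = e -> projection (cstar e ** e).
Proof.
move=> en ee; split; last by rewrite cstarM cstarK.
by rewrite {2}en cmulA -(cmulA _ e e) ee -cmulA -en cmulA -cstarM ee.
Qed.

(** Minimality is applied to e* e, where e is the idempotent multiple of an
    eigenvector of a; it forces e = p, so that a = a p is l p for the
    eigenvalue l. *)
Theorem minimal_projection_scalar a p : finite_dimensional A ->
  minimal_projection p -> cstar a = a -> p ** a = a -> exists l, a = l *: p.
Proof.
move=> fdA [[pp ps] p0 pmin] as_ pa.
have ap : a ** p = a by rewrite -as_ -{1}ps -cstarM pa.
have [l [Q [x0 ax]]] := poly_at_eigen a fdA p0; exists l; move: x0 ax.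
have : poly_at a p Q ** poly_at a p Q = poly_at a (p ** poly_at a p Q) Q.
  exact: poly_at_cmull.
have : p ** poly_at a p Q = poly_at a p Q.
  by rewrite poly_at_cmulr ?pp// pa ap.
have : a ** poly_at a p Q = poly_at a p Q ** a.
  by rewrite poly_at_comm// ap pa.
have : forall y, a ** y = y ** a -> y ** p = p ** y ->
    y ** poly_at a p Q = poly_at a p Q ** y.
  by move=> y ay yp; rewrite poly_at_cmulr// yp poly_at_cmull.
(* Only these properties of the eigenvector matter from here on. *)
set x := poly_at a p Q => xC xa px xx x0 ax.
move: xx; rewrite px (poly_at_eigenvector _ ax); set m := Q.[l] => xx.
have xp : x ** p = x by rewrite -[RHS]px xC// ?ap ?pa.
have pxs : p ** cstar x = cstar x by rewrite -{1}ps -cstarM xp.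
have xn : cstar x ** x = x ** cstar x.
  apply: xC; first by rewrite -[in LHS]as_ -[in RHS]as_ -!cstarM xa.
  by rewrite pxs -{1}ps -cstarM px.
(* x x = m x, and m = 0 would make the normal element x nilpotent. *)
have m0 : m != 0.
  by apply/eqP => m0; apply/x0/normal_square_eq0 => //; rewrite xx m0 scale0r.
pose e := m^-1 *: x.
have ee : e ** e = e.
  by rewrite /e cmulZl cmulZr xx !scalerA -mulrA mulVf// mulr1.
have en : cstar e ** e = e ** cstar e.
  by rewrite /e cstarZ !(cmulZl, cmulZr) xn !scalerA mulrC.
have pe : p ** e = e by rewrite /e cmulZr px.
have e0 : e <> 0.
  move=> /eqP; rewrite /e scaler_eq0 invr_eq0 (negbTE m0) => /eqP; exact: x0.
have ae : a ** e = l *: e by rewrite /e cmulZr ax !scalerA mulrC.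
have /pmin[/cstar_cmul_eq0//|fp] : subprojection (cstar e ** e) p.
  split; first exact: normal_idempotent_projection.
  by rewrite /e cstarZ !(cmulZl, cmulZr) cmulA pxs.
(* Since e is idempotent, e* e = p is unchanged by e on the right, so p = p e = e. *)
suff ep : e = p by rewrite -{1}ap -ep.
by rewrite -pe -fp -cmulA ee.
Qed.

End FiniteDimensional.

(** * Quantitative splitting in finite dimension *)

Section Sandwich.
Variables (R : realType) (A : cstarAlgType R).
Implicit Types (p q u v w x y : A) (e k : R).

Definition sandwich u w : A := u ** w ** u.

Lemma cstar_sandwich u w : cstar u = u -> cstar w = w ->
  cstar (sandwich u w) = sandwich u w.
Proof. by move=> us ws; rewrite /sandwich !cstarM us ws cmulA. Qed.

Lemma nrm_sandwich_dist u p w e k : nrm u <= 2 -> nrm p <= 1 -> nrm w <= k ->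
  nrm (u - p) <= e -> nrm (sandwich u w - sandwich p w) <= 3 * (e * k).
Proof.
move=> u2 p1 wk upe.
have -> : sandwich u w - sandwich p w = (u - p) ** w ** u + p ** (w ** (u - p)).
  by rewrite /sandwich !(cmulBl, cmulBr) !cmulA addrA subrK.
rewrite (le_trans (nrmD _ _))//.
have := nrm_le_cmul (nrm_le_cmul upe wk) u2.
have := nrm_le_cmul p1 (nrm_le_cmul wk upe).
lra.
Qed.

(** Makes the coefficient real, so that its absolute value determines it up to
    sign. *)
Lemma selfadjoint_multiple p a (l : R[i]) : cstar p = p -> p <> 0 ->
  cstar a = a -> a = l *: p -> exists r : R, a = real_complex R r *: p.
Proof.
move=> ps p0 as_ al; exists (complex.Re l); rewrite {1}al; congr (_ *: _).
have /eqP : (conjc l - l) *: p = 0.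
  by rewrite scalerBl -{1}ps -cstarZ -al as_ subrr.
rewrite scaler_eq0 => /orP[|/eqP//]; rewrite subr_eq0.
by case: l {al} => a' b /eqP[] b0; congr Complex; rewrite /=; lra.
Qed.

(** If w is close to r p with r real and |w| is close to 1, then r is close to 1
    or to -1.  This is why a sentence can say that an element is not a multiple
    of p: only the two multiples p and -p have to be excluded. *)
Lemma near_real_multiple u p w e (r : R) : projection p -> p <> 0 ->
  nrm (u - p) <= 10 * e -> nrm (w - real_complex R r *: p) <= 120 * e ->
  `|nrm w - 1| <= e ->
  nrm (w - u) <= 300 * e \/ nrm (w + u) <= 300 * e.
Proof.
move=> pP p0 upe wpe w1.
have p1 := nrm_projection pP p0.
have nZ (s : R) : nrm (real_complex R s *: p) = `|s| by rewrite nrmZR p1 mulr1.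
have rw : `| `|r| - nrm w | <= 120 * e.
  rewrite -nZ distrC.
  exact: le_trans (nrm_dist_dist _ _) wpe.
have e0 : 0 <= e by apply: le_trans w1.
have [r0|r0] := lerP 0 r; [left|right].
- have -> : w - u = (w - real_complex R r *: p) + real_complex R (r - 1) *: p - (u - p).
    rewrite rmorphB/= scalerBl scale1r addrA subrK opprB addrA subrK.
    by [].
  rewrite (le_trans (nrmB _ _))//.
  have := nrmD (w - real_complex R r *: p) (real_complex R (r - 1) *: p).
  rewrite nZ; move: rw w1; rewrite (ger0_norm r0) => rw w1.
  have : `|r - 1| <= 121 * e.
    by rewrite (le_trans (ler_distD (nrm w) _ _))//; lra.
  lra.
- have -> : w + u = (w - real_complex R r *: p) + real_complex R (r + 1) *: p + (u - p).
    rewrite rmorphD/= scalerDl scale1r (addrA (w - _)) subrK addrACA.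
    by rewrite subrr addr0.
  rewrite (le_trans (nrmD _ _))//.
  have := nrmD (w - real_complex R r *: p) (real_complex R (r + 1) *: p).
  rewrite nZ; move: rw w1; rewrite (ltr0_norm r0) => rw w1.
  have : `|- r - 1| <= 121 * e.
    by rewrite (le_trans (ler_distD (nrm w) _ _))//; lra.
  rewrite -opprD normrN; lra.
Qed.

(** The projection p near u cannot be minimal, because otherwise [sandwich p w]
    would be a multiple of p, and [sandwich u w] close to one. *)
Lemma finite_dimensional_split u w e : finite_dimensional A ->
  cstar u = u -> cstar w = w -> nrm w <= 4 -> e <= 1/200 ->
  nrm (defect u) <= e -> `|nrm (sandwich u w) - 1| <= e ->
  300 * e < nrm (sandwich u w - u) -> 300 * e < nrm (sandwich u w + u) ->
  exists p q, [/\ projection p, subprojection q p, nrm (u - p) <= 10 * e,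
                  q <> 0 & q <> p].
Proof.
move=> fdA us ws w4 e200 ue s1 sB sD.
have e8 : e <= 1/8 by lra.
have [p [pP upe _]] := near_projection us ue e8.
have u2 := nrm_selfadjoint_le us ue e8.
have [pp ps] := pP.
have spe : nrm (sandwich u w - sandwich p w) <= 120 * e.
  have := nrm_sandwich_dist u2 (nrm_projection_le1 pP) w4 upe; lra.
have p0 : p <> 0.
  move=> p0; move: spe s1; rewrite /sandwich p0 !cmulx0 subr0 ler_norml.
  by move=> spe /andP[]; lra.
apply: contrapT => nsplit.
have pmin : minimal_projection p.
  split=> // q qp; apply: contrapT => /not_orP[q0 qp']; apply: nsplit.
  by exists p, q.
have [|l al] := minimal_projection_scalar fdA pmin (cstar_sandwich ps ws).
  by rewrite /sandwich !cmulA pp.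
have [r ar] := selfadjoint_multiple ps p0 (cstar_sandwich ps ws) al.
rewrite ar in spe.
by have [] := near_real_multiple pP p0 upe spe s1; rewrite leNgt ?sB ?sD.
Qed.

End Sandwich.

(** * Splitting in ultraproducts *)

Section UltraproductSplit.
Variables (R : realType) (I : Type) (U : ultrafilter I).
Variable B : I -> cstarAlgType R.
Local Notation Q := (ultraproduct U B).
Implicit Types a b : bounded_family B.

Lemma uclassM a b : uclass U a ** uclass U b = uclass U (famM a b) :> Q.
Proof. exact: umul_uclass. Qed.

Lemma uclassS a : cstar (uclass U a) = uclass U (famS a) :> Q.
Proof. exact: ustar_uclass. Qed.

Lemma uclass_surj (x : Q) : exists a, x = uclass U a.
Proof. by exists (urepr x); rewrite ureprK. Qed.

Lemma ultra_norm_gt a (M : R) :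
  M < ultra_norm U a -> \forall i \near ultrafilter_sets U, M < nrm (a i).
Proof. by move=> aM; exact: (cvgr_gt _ (@ultra_cvg _ _ U _ a)). Qed.

Lemma ultra_norm_ge a (M : R) :
  (\forall i \near ultrafilter_sets U, M <= nrm (a i)) -> M <= ultra_norm U a.
Proof.
by move=> UM; apply: limr_ge => //; exact: (cvgP _ (@ultra_cvg _ _ U _ a)).
Qed.

Definition uclassEr := (uclassM, uclassS, =^~ @uclassD R I U B, =^~ @uclassN R I U B).

(** The bounds 1 <= |q| and 1 <= |p - q| are what remains of q_i <> 0 and
    q_i <> p_i in the limit: nonzero projections have norm exactly 1, so these
    inequations do not degenerate. *)
Lemma ultraproduct_split (x y : Q) e : (forall i, finite_dimensional (B i)) ->
  let u := cstar x ** x in let v := sandwich u (y + cstar y) in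
  nrm y <= 1 -> e <= 1/200 -> nrm (defect u) < e -> `|nrm v - 1| < e ->
  300 * e < nrm (v - u) -> 300 * e < nrm (v + u) ->
  exists p q : Q, [/\ projection p, subprojection q p, nrm (u - p) <= 10 * e,
                      1 <= nrm q & 1 <= nrm (p - q)].
Proof.
move=> fdB /=; have [a ->] := uclass_surj x; have [b ->] := uclass_surj y.
move=> b1 e200.
pose u i := cstar (a i) ** a i; pose w i := b i + cstar (b i).
pose v i := sandwich (u i) (w i).
rewrite /defect /sandwich !uclassEr ltr_distl => /[!nrm_uclass].
move=> /ultra_norm_lt due /andP[/ultra_norm_gt v1 /ultra_norm_lt v2].
move=> /ultra_norm_gt vBu /ultra_norm_gt vDu.
have {}b1 : \forall i \near ultrafilter_sets U, nrm (b i) < 2.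
  by apply: ultra_norm_lt; rewrite -nrm_uclass; lra.
pose good i := nrm (b i) < 2 /\ nrm (defect (u i)) < e /\
  1 - e < nrm (v i) < 1 + e /\ 300 * e < nrm (v i - u i) /\
  300 * e < nrm (v i + u i).
have Ugood : \forall i \near ultrafilter_sets U, good i.
  near=> i; do !split; try apply/andP; try split; near: i.
  exact: b1. exact: due. exact: v1. exact: v2. exact: vBu. exact: vDu.
have pq_ex i : exists pq : B i * B i, [/\ projection pq.1, subprojection pq.2 pq.1 &
    good i -> [/\ nrm (u i - pq.1) <= 10 * e, pq.2 <> 0 & pq.2 <> pq.1]].
  have [gi|ngi] := pselect (good i); last first.
    (* The other indices form a set outside U, where any values will do. *)
    exists (0, 0); split=> //=; do !split; rewrite ?cmul0x ?cstar0//.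
  have [bi [ui [/andP[vi vi'] [vBi vDi]]]] := gi.
  have us : cstar (u i) = u i by rewrite /u cstarM cstarK.
  have ws : cstar (w i) = w i by rewrite /w cstarD cstarK addrC.
  have w4 : nrm (w i) <= 4.
    by have := nrmD (b i) (cstar (b i)); rewrite nrm_cstar -/(w i); lra.
  have vi1 : `|nrm (v i) - 1| <= e by rewrite ler_distl !ltW.
  have [p [q [? ? ? ? ?]]] :=
    finite_dimensional_split (fdB i) us ws w4 e200 (ltW ui) vi1 vBi vDi.
  by exists (p, q).
pose pf i := (sval (cid (pq_ex i))).1; pose qf i := (sval (cid (pq_ex i))).2.
have pP i : projection (pf i) by rewrite /pf; case: cid => ? [].
have qP i : subprojection (qf i) (pf i) by rewrite /pf /qf; case: cid => ? [].
have good_pq i : good i -> [/\ nrm (u i - pf i) <= 10 * e, qf i <> 0 & qf i <> pf i].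
  by rewrite /pf /qf; case: cid => ? [].
have pB : exists M : R, forall i, nrm (pf i) <= M.
  by exists 1 => i; exact: nrm_projection_le1.
have qB : exists M : R, forall i, nrm (qf i) <= M.
  by exists 1 => i; have [/nrm_projection_le1] := qP i.
exists (uclass U (BoundedFamily pB)), (uclass U (BoundedFamily qB)).
split.
- by split; rewrite !uclassEr; congr uclass; apply: bounded_familyP => i;
    have [] := pP i.
- by split; first split; rewrite !uclassEr; congr uclass;
    apply: bounded_familyP => i; have [[]] := qP i.
- rewrite !uclassEr nrm_uclass; apply: ultra_norm_le.
  by apply: filterS Ugood => i /good_pq[].
- rewrite nrm_uclass; apply: ultra_norm_ge; apply: filterS Ugood => i.
  by move=> /good_pq[_ q0 _]; have [/nrm_projection/(_ q0)/= ->] := qP i.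
- rewrite !uclassEr nrm_uclass; apply: ultra_norm_ge; apply: filterS Ugood => i.
  move=> /good_pq[_ _ qp].
  have /nrm_projection -> // := projectionB (pP i) (qP i).
  by move/eqP; rewrite subr_eq0 => /eqP pq; exact: qp.
Unshelve. all: by end_near.
Qed.

End UltraproductSplit.

(** * Formulae *)

Section Connectives.
Variable R : realType.
Implicit Types (phi psi : formula R) (P : star_poly R).

Lemma max_coord_continuous :
  continuous (fun v : 'rV[R]_2 => Num.max (v ord0 ord0) (v ord0 ord_max)).
Proof. by move=> v; apply: continuous_max; exact: coord_continuous. Qed.

Lemma min_coord_continuous :
  continuous (fun v : 'rV[R]_2 => Num.min (v ord0 ord0) (v ord0 ord_max)).
Proof. by move=> v; apply: continuous_min; exact: coord_continuous. Qed.

Lemma affine_coord_continuous (s c : R) :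
  continuous (fun v : 'rV[R]_1 => s * v ord0 ord0 + c).
Proof.
move=> v; have h := @coord_continuous R 1 1 ord0 ord0 v.
exact: (cvgD (cvgM (cvg_cst s) h) (cvg_cst c)).
Qed.

Definition pair_args phi psi (i : 'I_2) := if val i is 0 then phi else psi.

Definition fmax phi psi := FConn max_coord_continuous (pair_args phi psi).
Definition fmin phi psi := FConn min_coord_continuous (pair_args phi psi).
Definition faffine s c phi := FConn (@affine_coord_continuous s c) (fun=> phi).

Definition psub P P' := PAdd P (PScale (-1) P').
Definition psquare P := PMul (PStar P) P.
Definition psandwich P P' := PMul (PMul P P') P.
Definition pdefect P := psub (PMul P P) P.

Definition lower c P := faffine 1 (- c) (FNorm P).
Definition upper c P := faffine (-1) c (FNorm P).

Section Eval.
Variable A : cstarAlgType R.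
Implicit Type e : nat -> A.

Lemma eval_fmax e phi psi :
  Defs.eval e (fmax phi psi) = Num.max (Defs.eval e phi) (Defs.eval e psi).
Proof. by rewrite /= !mxE. Qed.

Lemma eval_fmin e phi psi :
  Defs.eval e (fmin phi psi) = Num.min (Defs.eval e phi) (Defs.eval e psi).
Proof. by rewrite /= !mxE. Qed.

Lemma poly_eval_sub e P P' :
  poly_eval e (psub P P') = poly_eval e P - poly_eval e P'.
Proof. by rewrite /= scaleN1r. Qed.

Lemma poly_eval_defect e P : poly_eval e (pdefect P) = defect (poly_eval e P).
Proof. by rewrite poly_eval_sub. Qed.

Lemma eval_FSup e x psi :
  Defs.eval e (FSup x psi) = sup [set Defs.eval (assign e x a) psi | a in @unit_ball R A].
Proof. by []. Qed.

Lemma eval_FInf e x psi :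
  Defs.eval e (FInf x psi) = inf [set Defs.eval (assign e x a) psi | a in @unit_ball R A].
Proof. by []. Qed.

Lemma eval_lower e c P : Defs.eval e (lower c P) = nrm (poly_eval e P) - c.
Proof. by rewrite /= mxE mul1r. Qed.

Lemma eval_upper e c P : Defs.eval e (upper c P) = c - nrm (poly_eval e P).
Proof. by rewrite /= mxE mulN1r addrC. Qed.

End Eval.

Lemma free_in_pair x phi psi :
  (exists i, free_in x (pair_args phi psi i)) -> free_in x phi \/ free_in x psi.
Proof. by move=> [[[|[|//]] ?]] /=; [left|right]. Qed.

End Connectives.

(** * The sentence and its values *)

Section Sentence.
Variable R : realType.

Definition square_poly : star_poly R := psquare (PVar R 0).
Definition corner_real_poly : star_poly R :=
  psandwich square_poly (PAdd (PVar R 1) (PStar (PVar R 1))).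
Definition corner_square_poly : star_poly R := psandwich square_poly (psquare (PVar R 2)).

(** Positive exactly when w = u z* z u, where u = x* x, has small defect and is
    far from 0 and from u.  An element of defect below 1/40 is within 1/4 of a projection by
    [near_projection], hence the thresholds 1/2. *)
Definition split_formula : formula R :=
  fmin (upper (1/40) (pdefect corner_square_poly))
    (fmin (lower (1/2) corner_square_poly) (lower (1/2) (psub square_poly corner_square_poly))).

(** The maximum of six quantities, each nonpositive exactly when one of the
    conditions on x and y holds. *)
Definition witness_formula (d : R) : formula R :=
  fmax (FNorm (pdefect square_poly))
  (fmax (upper 1 corner_real_poly)
  (fmax (lower 1 corner_real_poly)
  (fmax (upper d (psub corner_real_poly square_poly))
  (fmax (upper d (PAdd corner_real_poly square_poly))
    (FSup 2 split_formula))))).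

Definition unsplit_sentence (d : R) : formula R :=
  FInf 0 (FInf 1 (witness_formula d)).

Lemma unsplit_sentenceP (d : R) : sentence (unsplit_sentence d).
Proof.
move=> x [x0 [x1]].
do 5![move=> /free_in_pair[]; first by [rewrite /=; tauto|case=> _; rewrite /=; tauto]].
move=> [x2].
do 2![move=> /free_in_pair[]; first by [case=> _; rewrite /=; tauto]].
by case=> _ /=; tauto.
Qed.

Section Values.
Variable A : cstarAlgType R.
Implicit Types x y z : A.

Definition corner_square x z : A := sandwich (cstar x ** x) (cstar z ** z).
Definition corner_real x y : A := sandwich (cstar x ** x) (y + cstar y).

Definition split_value x z : R :=
  Num.min (1/40 - nrm (defect (corner_square x z)))
    (Num.min (nrm (corner_square x z) - 1/2)
             (nrm (cstar x ** x - corner_square x z) - 1/2)).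

Definition witness_value (d : R) x y : R :=
  Num.max (nrm (defect (cstar x ** x)))
  (Num.max (1 - nrm (corner_real x y))
  (Num.max (nrm (corner_real x y) - 1)
  (Num.max (d - nrm (corner_real x y - cstar x ** x))
  (Num.max (d - nrm (corner_real x y + cstar x ** x))
     (sup [set split_value x z | z in @unit_ball R A]))))).

Lemma eval_split e : Defs.eval e split_formula = split_value (e 0) (e 2) :> R.
Proof.
by rewrite !eval_fmin !eval_lower eval_upper poly_eval_defect poly_eval_sub.
Qed.

Lemma eval_witness d e : Defs.eval e (witness_formula d) = witness_value d (e 0) (e 1) :> R.
Proof.
rewrite !eval_fmax !eval_upper eval_lower eval_FSup !poly_eval_sub.
congr (Num.max _ (Num.max _ (Num.max _ (Num.max _ (Num.max _ (sup _)))))).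
  exact: (congr1 (@nrm _ _) (poly_eval_defect e square_poly)).
apply: eq_imagel => z _.
exact: eval_split.
Qed.

Lemma value_unsplit d : value A (unsplit_sentence d) =
  inf [set inf [set witness_value d x y | y in @unit_ball R A] | x in @unit_ball R A].
Proof.
rewrite /value eval_FInf; congr inf; apply: eq_imagel => x _.
by rewrite eval_FInf; congr inf; apply: eq_imagel => y _; exact: eval_witness.
Qed.

Lemma unit_ball0 : @unit_ball R A 0.
Proof. by rewrite /unit_ball/= nrm0. Qed.

(** The values are bounded above by 1/40, so that their supremum is a true one. *)
Lemma split_value_le_sup x z : unit_ball z ->
  split_value x z <= sup [set split_value x z | z in @unit_ball R A].
Proof.
move=> z1; apply: ub_le_sup; last by exists z.
exists (1/40) => _ [z' _ <-]; rewrite /split_value ge_min.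
by rewrite gerBl nrm_ge0.
Qed.

Lemma sup_split_value_le x (c : R) :
  (forall z, unit_ball z -> split_value x z <= c) ->
  sup [set split_value x z | z in @unit_ball R A] <= c.
Proof.
move=> h; apply: ge_sup; first by exists (split_value x 0), 0 => //; exact: unit_ball0.
by move=> _ [z z1 <-]; exact: h.
Qed.

Lemma witness_value_ge0 d x y : 0 <= witness_value d x y.
Proof. by rewrite /witness_value le_max nrm_ge0. Qed.

Lemma value_unsplit_le d x y : unit_ball x -> unit_ball y ->
  value A (unsplit_sentence d) <= witness_value d x y.
Proof.
move=> x1 y1; rewrite value_unsplit.
have lb x' : has_lbound [set witness_value d x' y | y in @unit_ball R A].
  by exists 0 => _ [y' _ <-]; exact: witness_value_ge0.
apply: (@le_trans _ _ (inf [set witness_value d x y | y in @unit_ball R A])).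
  apply: ge_inf; last by exists x.
  exists 0 => _ [x' _ <-]; apply: lb_le_inf; last first.
    by move=> _ [y' _ <-]; exact: witness_value_ge0.
  by exists (witness_value d x' 0), 0 => //; exact: unit_ball0.
by apply: ge_inf => //; exists y.
Qed.

Lemma value_unsplit_lt d c : value A (unsplit_sentence d) < c ->
  exists x y, [/\ unit_ball x, unit_ball y & witness_value d x y < c].
Proof.
rewrite value_unsplit => /inf_lt[].
  by exists (inf [set witness_value d 0 y | y in @unit_ball R A]), 0 => //; exact: unit_ball0.
move=> _ [x x1 <-] /inf_lt[].
  by exists (witness_value d x 0), 0 => //; exact: unit_ball0.
by move=> _ [y y1 <-] xy; exists x, y.
Qed.

End Values.

(** The values x = p and y = a / 2 give x* x = p and y + y* = a. *)
Lemma minimal_value (A : cstarAlgType R) (p a : A) (d : R) :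
  minimal_projection p -> cstar a = a -> p ** a = a -> nrm a = 1 ->
  d <= nrm (a - p) -> d <= nrm (a + p) -> value A (unsplit_sentence d) <= 0.
Proof.
move=> [[pp ps] p0 pmin] as_ pa a1 daB daD.
have ap : a ** p = a by rewrite -as_ -{1}ps -cstarM pa.
pose y : A := real_complex R (1/2) *: a.
have yy : y + cstar y = a.
  rewrite /y cstarZR as_ -scalerDl -rmorphD/=.
  by rewrite (_ : 1/2 + 1/2 = 1 :> R) ?scale1r//; lra.
apply: (@le_trans _ _ (witness_value d p y)).
  apply: value_unsplit_le; rewrite /unit_ball/=.
    by apply: nrm_projection_le1.
  by rewrite nrmZR a1 mulr1 ger0_norm; lra.
rewrite /witness_value /corner_real yy ps pp /defect pp subrr nrm0.
rewrite /sandwich pa ap a1 subrr !ge_max !subr_le0 lexx daB daD/=.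
apply: sup_split_value_le => z _; rewrite /split_value leNgt; apply/negP.
set w := corner_square p z.
have ws : cstar w = w.
  by apply: cstar_sandwich; rewrite cstarM cstarK.
have pw : p ** w = w by rewrite /w /corner_square /sandwich ps pp !cmulA pp.
rewrite ps pp !lt_min !subr_gt0 => /andP[dw /andP[w2 pw2]].
have [|q [qP wq /(_ _ pw) pq]] := near_projection ws (ltW dw); first lra.
have [q0|qp] := pmin q (conj qP pq).
  by move: wq; rewrite q0 subr0; lra.
by move: wq; rewrite qp nrm_distC; lra.
Qed.

(** As q lies below p, it equals p q p, so w = u q u is close to it when u is
    close to p.  The resulting error 120 e in the defect of w is what e must keep
    below 1/40. *)
Lemma split_value_ge (A : cstarAlgType R) (x p q : A) (e : R) :
  let u := cstar x ** x in
  projection p -> subprojection q p -> nrm (defect u) <= e -> e <= 1/5000 ->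
  nrm (u - p) <= 10 * e -> 1 <= nrm q -> 1 <= nrm (p - q) ->
  e <= split_value x q.
Proof.
move=> u pP qP ue e5000 upe q1 pq1.
have us : cstar u = u by rewrite /u cstarM cstarK.
have e8 : e <= 1/8 by lra.
have u2 := nrm_selfadjoint_le us ue e8.
have [qq_ pq] := qP; have [qq qs] := qq_.
have qn1 := nrm_projection_le1 qq_.
have qp := subprojectionC pP qP.
have wq := nrm_sandwich_dist u2 (nrm_projection_le1 pP) qn1 upe.
rewrite {2}/sandwich pq qp in wq.
rewrite /split_value /corner_square qs qq -/u; move: wq.
set w := sandwich u q => wq.
have wn : nrm q - nrm w <= nrm (w - q).
  by rewrite nrm_distC; have := nrmD (q - w) w; rewrite subrK; lra.
have pwn : nrm (p - q) <= nrm (u - w) + nrm (w - q) + nrm (u - p).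
  rewrite (nrm_distC u p); have := nrm_distD u p q; have := nrm_distD w u q; lra.
have w2 : nrm w <= 2 by have := nrmD (w - q) q; rewrite subrK; lra.
have dw : nrm (defect w) <= 120 * e.
  have -> : defect w = (w - q) ** w + q ** (w - q) - (w - q).
    by rewrite /defect cmulBl cmulBr qq addrA subrK opprB addrA subrK.
  have := nrmB ((w - q) ** w + q ** (w - q)) (w - q).
  have := nrmD ((w - q) ** w) (q ** (w - q)).
  have := nrm_le_cmul wq w2; have := nrm_le_cmul qn1 wq; lra.
by rewrite !le_min; apply/and3P; split; lra.
Qed.

(** A value at most 0 yields x and y satisfying all conditions up to e, and
    [ultraproduct_split] then gives a q for which the last one fails. *)
Lemma ultraproduct_value (I : Type) (U : ultrafilter I)
    (B : I -> cstarAlgType R) (d : R) :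
  (forall i, finite_dimensional (B i)) -> 0 < d <= 2 ->
  0 < value (ultraproduct U B) (unsplit_sentence d).
Proof.
move=> fdB /andP[d0 d2]; rewrite ltNge; apply/negP => v0.
have [e [e0 e5000 e200 ed]] : exists e : R,
    [/\ 0 < e, e <= 1/5000, e <= 1/200 & 300 * e < d - e].
  by exists (d / 10000); split; lra.
have [x [y [_ y1]]] := value_unsplit_lt (le_lt_trans v0 e0).
rewrite /witness_value !gt_max => /andP[ue] /andP[v1] /andP[v1'].
move=> /andP[vBu] /andP[vDu] split_lt.
have vn : `|nrm (corner_real x y) - 1| < e.
  by rewrite ltr_distl ltrBlDr -ltrBlDl v1 -ltrBlDl v1'.
rewrite ltrBlDr -ltrBlDl in vBu; rewrite ltrBlDr -ltrBlDl in vDu.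
have [p [q [pP qP upe q1 pq1]]] :=
  ultraproduct_split fdB y1 e200 ue vn (lt_trans ed vBu) (lt_trans ed vDu).
have qn1 : unit_ball q := nrm_projection_le1 qP.1.
have := le_lt_trans (split_value_le_sup x qn1) split_lt.
by rewrite ltNge (split_value_ge pP qP (ltW ue)).
Qed.

End Sentence.

(** * Minimal projections *)

Theorem proposition5p3 (R : realType) (A : cstarAlgType R)
    (hA : pseudocompact A) (p : A) (hp : projection p) (hp0 : p <> 0) :
  minimal_projection p <-> corner p = scalar_multiples p.
Proof.
have [pp ps] := hp; split=> [pmin|cornerE]; last first.
  split=> // q [[qq qs] pq].
  have qp : q ** p = q by apply: (subprojectionC hp).
  have : corner p q by exists q => //; rewrite pq qp.
  rewrite cornerE => -[c _ cq].
  have : (c * (c - 1)) *: p = 0.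
    rewrite mulrBr mulr1 scalerBl -scalerA; apply/eqP; rewrite subr_eq0.
    by apply/eqP; rewrite cq -[RHS]qq -{2}cq cmulZl pq.
  move=> /eqP; rewrite scaler_eq0 mulf_eq0 subr_eq0 => /orP[/orP[]|] /eqP.
  - by move=> c0; left; rewrite -cq c0 scale0r.
  - by move=> c1; right; rewrite -cq c1 scale1r.
  - by [].
have sa_scalar h : cstar h = h -> p ** h = h -> exists c : R[i], h = c *: p.
  have [-> _ _|/eqP h0] := eqVneq h 0; first by exists 0; rewrite scale0r.
  (* If h is not a multiple of p, the sentence separates A from the ultraproduct. *)
  move=> hs ph; apply: contrapT => h_nscalar.
  have [I [U [B [fdB /(_ _ (@unsplit_sentenceP R _)) AQ]]]] := hA.
  have hn := nrm_gt0 h0.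
  pose a := real_complex R (nrm h)^-1 *: h.
  have a1 : nrm a = 1.
    by rewrite nrmZR ger0_norm ?invr_ge0 ?ltW// mulVf// lt0r_neq0.
  have ha : h = real_complex R (nrm h) *: a.
    by rewrite scalerA -rmorphM/= divff ?lt0r_neq0// scale1r.
  have aBp : 0 < nrm (a - p).
    apply: nrm_gt0 => /eqP; rewrite subr_eq0 => /eqP ap.
    by apply: h_nscalar; rewrite ha ap; eexists.
  have aDp : 0 < nrm (a + p).
    apply: nrm_gt0 => /eqP; rewrite addr_eq0 => /eqP ap.
    by apply: h_nscalar; rewrite ha ap -scaleN1r scalerA; eexists.
  pose d := Num.min (nrm (a - p)) (nrm (a + p)).
  have : 0 < value (ultraproduct U B) (unsplit_sentence d).
    apply: ultraproduct_value => //; rewrite /d lt_min aBp aDp ge_min.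
    apply/orP; left; have := nrmB a p; rewrite a1 (nrm_projection hp hp0); lra.
  rewrite -AQ ltNge => /negP; apply.
  apply: (minimal_value pmin _ _ a1); rewrite /d ?ge_min ?lexx ?orbT//.
    by rewrite /a cstarZR hs.
  by rewrite /a cmulZr ph.
apply/seteqP; split=> [_ [x _ <-]|_ [c _ <-]]; last first.
  by exists (c *: p) => //; rewrite cmulZr cmulZl !pp.
set y := p ** x ** p.
have ys : cstar y = p ** cstar x ** p by rewrite /y !cstarM ps cmulA.
have [|| c1 c1E] := sa_scalar (y + cstar y).
- by rewrite cstarD cstarK addrC.
- by rewrite cmulDr ys /y !cmulA pp.
have [|| c2 c2E] := sa_scalar ('i%C *: (y - cstar y)).
- by rewrite cstarZi cstarB cstarK -scalerN opprB.
- by rewrite cmulZr cmulBr ys /y !cmulA pp.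
(* y + y* is twice the real part of y, and i (-y* + y) is -2 times the
   imaginary part. *)
exists (2^-1 * (c1 - 'i%C * c2)) => //.
rewrite -scalerA scalerBl -scalerA -c1E -c2E scalerA.
have -> : 'i%C * 'i%C = -1 :> R[i] by simpc.
rewrite scaleN1r opprK addrACA subrr addr0 -mulr2n -[y *+ 2]scaler_nat scalerA.
by rewrite mulVf ?scale1r// pnatr_eq0.
Qed.
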